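(* Let $X$ be a Banach space over $\mathbb{F}$ ($\mathbb{F}=\mathbb{R}$ or $\mathbb{C}$), let $\mathcal{L}$ be a subspace lattice on $X$ such that $\vee\{L:L\in\mathcal{P}_{\mathcal{L}}\}=X$ or $\wedge\{L_-:L\in\mathcal{P}_{\mathcal{L}}\}=(0)$, and let $\delta:\mathrm{Alg}\mathcal{L}\to B(X)$ be a linear mapping. Then $\delta$ is derivable at zero point if and only if $\delta$ is a generalized derivation and $\delta(I)\in(\mathrm{Alg}\mathcal{L})'$. In particular, if $\delta(I)=0$, then $\delta$ is derivable at zero point if and only if $\delta$ is a derivation.
   Context: $B(X)$ is the algebra of bounded linear operators on $X$. A subspace of $X$ means a norm-closed linear manifold. A subspace lattice on $X$ is a collection $\mathcal{L}$ of subspaces of $X$ containing $(0)$ and $X$ such that for every family $\{M_r\}$ in $\mathcal{L}$ the intersection $\wedge M_r$ and the closed linear span $\vee M_r$ belong to $\mathcal{L}$ (the closed span of an empty family is $(0)$, and the intersection of an empty family is $X$). $\mathrm{Alg}\mathcal{L}$ is the algebra of operators in $B(X)$ that leave every member of $\mathcal{L}$ invariant, and $(\mathrm{Alg}\mathcal{L})'$ is its commutant in $B(X)$. For $E\in\mathcal{L}$, $E_-=\vee\{F\in\mathcal{L}:F\nsupseteq E\}$, and $\mathcal{P}_{\mathcal{L}}=\{L\in\mathcal{L}:L_-\nsupseteq L\}$. A linear mapping $\delta:\mathrm{Alg}\mathcal{L}\to B(X)$ is derivable at zero point if $\delta(AB)=\delta(A)B+A\delta(B)$ for all $A,B\in\mathrm{Alg}\mathcal{L}$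 with $AB=0$. It is a derivation if $\delta(AB)=\delta(A)B+A\delta(B)$ for all $A,B$, and a generalized derivation if $\delta(AB)=\delta(A)B+A\delta(B)-A\delta(I)B$ for all $A,B$. *)

(* Defs.v *)
From HB Require Import structures.
From mathcomp Require Import all_boot all_order all_algebra.
From mathcomp Require Import complex.
From mathcomp Require Import all_classical all_reals all_analysis.

Set Implicit Arguments.
Unset Strict Implicit.
Unset Printing Implicit Defensive.

Import Order.TTheory GRing.Theory Num.Theory.
Import numFieldNormedType.Exports.

Local Open Scope classical_set_scope.
Local Open Scope ring_scope.

Inductive scalar_kind : Set := RealScalars | ComplexScalars.

Definition scalars (R : realType) (k : scalar_kind) : numFieldType :=
  match k with
  | RealScalars => R
  | ComplexScalars => R[i]%C
  end.

Section BoundedOperators.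
Context (K : numFieldType) (X : normedModType K).

(* For K = R[i] the norm is K-valued and [<=] is the partial order of K, so
   that M is necessarily a nonnegative real unless X is zero. *)
Definition bounded_linear (f : X -> X) : Prop :=
  linear f /\ exists M : K, forall x : X, `|f x| <= M * `|x|.

Definition bounded_linear_pred : {pred X -> X} :=
  [pred f | `[< bounded_linear f >]].

Record bounded_op := BoundedOp {
  bop_fun :> X -> X;
  bop_subproof : bop_fun \in bounded_linear_pred
}.

HB.instance Definition _ := [isSub for bop_fun].
HB.instance Definition _ := [Choice of bounded_op by <:].

Lemma bounded_linearP (f : X -> X) :
  reflect (bounded_linear f) (f \in bounded_linear_pred).
Proof. by rewrite unfold_in /=; exact: asboolP. Qed.

Lemma bounded_linear_submod_closed : submod_closed bounded_linear_pred.
Proof.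
split.
  apply/bounded_linearP; split=> [a x y|]; first by rewrite /= scaler0 addr0.
  by exists 0 => x; rewrite normr0 mul0r.
move=> a f g /bounded_linearP[lf [M fM]] /bounded_linearP[lg [N gN]].
apply/bounded_linearP; split=> [b x y|].
  rewrite !fctE lf lg !scalerDr !scalerA [b * a]mulrC -!addrA; congr (_ + _).
  by rewrite addrCA.
exists (`|a| * M + N) => x; rewrite mulrDl -mulrA.
apply: (le_trans (ler_normD _ _)); apply: lerD => //.
by rewrite normrZ ler_wpM2l.
Qed.

HB.instance Definition _ := GRing.isSubmodClosed.Build K (X -> X)
  bounded_linear_pred bounded_linear_submod_closed.
HB.instance Definition _ := [SubChoice_isSubLmodule of bounded_op by <:].

Lemma bopP (A : bounded_op) : bounded_linear A.
Proof. exact/bounded_linearP/bop_subproof. Qed.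

Lemma bop_id_subproof : idfun \in bounded_linear_pred.
Proof.
by apply/bounded_linearP; split=> //; exists 1 => x; rewrite mul1r.
Qed.

Lemma bop_comp_subproof (A B : bounded_op) :
  (A : X -> X) \o (B : X -> X) \in bounded_linear_pred.
Proof.
have [lA [M AM]] := bopP A; have [lB [N BN]] := bopP B.
apply/bounded_linearP; split=> [a x y|]; first by rewrite /= lB lA.
exists (`|M| * N) => x /=; rewrite -mulrA.
apply: (le_trans (AM _)).
have [/eqP B0|B0] := boolP (`|B x| == 0).
  rewrite B0 mulr0 mulr_ge0//; apply: le_trans (BN x); exact: normr_ge0.
have Mge0 : 0 <= M.
  have := le_trans (normr_ge0 _) (AM (B x)).
  by rewrite pmulr_lge0// lt_def B0 normr_ge0.
by rewrite ger0_norm// ler_wpM2l.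
Qed.

Definition bop_id := BoundedOp bop_id_subproof.
Definition bop_comp (A B : bounded_op) := BoundedOp (bop_comp_subproof A B).

Lemma bop_ext (A B : bounded_op) : (forall x, A x = B x) -> A = B.
Proof. by move=> AB; apply/val_inj/funext. Qed.

Let bop_compA : associative bop_comp.
Proof. by move=> A B C; exact: bop_ext. Qed.
Let bop_comp1l : left_id bop_id bop_comp.
Proof. by move=> A; exact: bop_ext. Qed.
Let bop_comp1r : right_id bop_id bop_comp.
Proof. by move=> A; exact: bop_ext. Qed.
Let bop_compDl : left_distributive bop_comp +%R.
Proof. by move=> A B C; exact: bop_ext. Qed.
Let bop_compDr : right_distributive bop_comp +%R.
Proof.
move=> A B C; apply: bop_ext => x.
by have [lA _] := bopP A; have /= := lA 1 (B x) (C x); rewrite !scale1r.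
Qed.

(* Not an [nzRingType] (hence not an [algType]): X may be the zero space. *)
HB.instance Definition _ := GRing.Zmodule_isPzRing.Build bounded_op
  bop_compA bop_comp1l bop_comp1r bop_compDl bop_compDr.

Lemma bopD (A B : bounded_op) x : (A + B) x = A x + B x. Proof. by []. Qed.
Lemma bopN (A : bounded_op) x : (- A) x = - A x. Proof. by []. Qed.
Lemma bopZ a (A : bounded_op) x : (a *: A) x = a *: A x. Proof. by []. Qed.
Lemma bopM (A B : bounded_op) x : (A * B) x = A (B x). Proof. by []. Qed.
Lemma bop0 x : (0 : bounded_op) x = 0. Proof. by []. Qed.
Lemma bop1 x : (1 : bounded_op) x = x. Proof. by []. Qed.

Definition commutant (S : set bounded_op) : set bounded_op :=
  [set T | forall A, S A -> T * A = A * T].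

End BoundedOperators.

Section SubspaceLattices.
Context (K : numFieldType) (X : normedModType K).

Definition subspace (M : set X) : Prop := submod_closed (mem M) /\ closed M.

Definition linear_span (S : set X) : set X :=
  [set x | exists (n : nat) (a : 'I_n -> K) (v : 'I_n -> X),
     (forall i, S (v i)) /\ x = \sum_(i < n) a i *: v i].

Definition closed_span (S : set X) : set X := closure (linear_span S).

Definition meet (G : set (set X)) : set X := \bigcap_(M in G) M.
Definition join (G : set (set X)) : set X := closed_span (\bigcup_(M in G) M).

Record subspace_lattice := SubspaceLattice {
  members :> set (set X);
  members_subspace : forall M, members M -> subspace M;
  members0 : members [set 0];
  membersT : members setT;
  members_meet : forall G, G `<=` members -> members (meet G);
  members_join : forall G, G `<=` members -> members (join G)
}.

(* [lower L E] is E_- and [PL L] is P_L. *)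
Definition lower (L : subspace_lattice) (E : set X) : set X :=
  join [set F | members L F /\ ~ (E `<=` F)].

Definition PL (L : subspace_lattice) : set (set X) :=
  [set E | members L E /\ ~ (E `<=` lower L E)].

End SubspaceLattices.

Section Alg.
Context (K : numFieldType) (X : normedModType K) (L : subspace_lattice X).

Definition alg_set : set (bounded_op X) :=
  [set A | forall M, members L M -> forall x, M x -> M (A x)].

Definition alg_pred : {pred bounded_op X} := [pred A | `[< alg_set A >]].

Record alg := AlgOp {
  alg_op :> bounded_op X;
  alg_subproof : alg_op \in alg_pred
}.

HB.instance Definition _ := [isSub for alg_op].
HB.instance Definition _ := [Choice of alg by <:].

Lemma alg_setP (A : bounded_op X) : reflect (alg_set A) (A \in alg_pred).
Proof. by rewrite unfold_in /=; exact: asboolP. Qed.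

Lemma alg_submod_closed : submod_closed alg_pred.
Proof.
split.
  apply/alg_setP => M /members_subspace[[M0 _] _] x _ /=.
  by have := M0; rewrite inE.
move=> a A B /alg_setP hA /alg_setP hB; apply/alg_setP => M LM x Mx.
have [[_ lM] _] := members_subspace LM.
have := lM a (A x) (B x).
by rewrite !inE; apply; [exact: hA | exact: hB].
Qed.

Lemma alg_mulr_closed : mulr_closed alg_pred.
Proof.
split; first exact/alg_setP.
move=> A B /alg_setP hA /alg_setP hB; apply/alg_setP => M LM x Mx.
by apply: hA => //; exact: hB.
Qed.

HB.instance Definition _ := GRing.isSubmodClosed.Build K (bounded_op X)
  alg_pred alg_submod_closed.
HB.instance Definition _ := GRing.isMulClosed.Build (bounded_op X)
  alg_pred alg_mulr_closed.
HB.instance Definition _ := GRing.SubChoice_isSubPzRing.Build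
  (bounded_op X) alg_pred alg (subringClosedP _).
HB.instance Definition _ := [SubZmodule_isSubLmodule of alg by <:].

Lemma alg_op1 : alg_op 1 = 1. Proof. by []. Qed.
Lemma alg_op0 : alg_op 0 = 0. Proof. by []. Qed.
Lemma alg_opM (A B : alg) : alg_op (A * B) = alg_op A * alg_op B.
Proof. by []. Qed.
Lemma alg_opD (A B : alg) : alg_op (A + B) = alg_op A + alg_op B.
Proof. by []. Qed.
Lemma alg_opZ a (A : alg) : alg_op (a *: A) = a *: alg_op A.
Proof. by []. Qed.

Definition derivable_at_zero (delta : alg -> bounded_op X) : Prop :=
  forall A B : alg, A * B = 0 ->
    delta (A * B) = delta A * alg_op B + alg_op A * delta B.

Definition derivation (delta : alg -> bounded_op X) : Prop :=
  forall A B : alg, delta (A * B) = delta A * alg_op B + alg_op A * delta B.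

Definition generalized_derivation (delta : alg -> bounded_op X) : Prop :=
  forall A B : alg,
    delta (A * B) = delta A * alg_op B + alg_op A * delta B
                    - alg_op A * delta 1 * alg_op B.

End Alg.

(* Main.v *)
Require Import Defs.
From mathcomp Require Import all_boot all_order all_algebra.
From mathcomp Require Import complex ring lra.
From mathcomp Require Import all_classical all_reals all_analysis.

Import Order.TTheory GRing.Theory Num.Theory numFieldNormedType.Exports.
Local Open Scope classical_set_scope.
Local Open Scope ring_scope.

(** If delta is derivable at zero then phi(A, B) = delta(A) B + A delta(B)
    vanishes whenever A B = 0; applied to A P (1 - P) B = 0 and
    A (1 - P) P B = 0 this gives phi(A P, B) = phi(A, P B) for every idempotent
    P, hence for every P in the algebra generated by idempotents.  That algebra
    contains each rank-one operator x (x) f with x in E in P_L and f in the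
    annihilator of E_-.  Specialising A = 1 or B = 1 shows that delta obeys the
    generalized Leibniz rule on products with such a rank-one operator T and
    that delta(1) commutes with T.  As A T and T A are of the same kind, every
    required identity holds after multiplication by all T on the right, which
    suffices if the E in P_L span X, or on the left, which suffices if the E_-
    meet in 0.  The functionals come from the Hahn-Banach theorem, obtained here
    from the fact that minimal sublinear functionals are linear. *)

(** * Hahn-Banach separation *)

Section RealHahnBanach.
Context {R : realType} {K : pzRingType} (iota : {rmorphism R -> K}).
Context {V : lmodType K}.
Implicit Types (p q : V -> R).

(** Scalars act through [iota], so that one argument serves real spaces and complex spaces
    restricted to real scalars. *)
Definition sublinear q :=
  (forall x y, q (x + y) <= q x + q y) /\
  (forall a x, 0 <= a -> q (iota a *: x) <= a * q x).

Lemma sublinear0 q : sublinear q -> q 0 = 0.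
Proof.
move=> [qD qZ]; have := qD 0 0; have := qZ 0 0 (lexx _).
by rewrite scaler0 addr0 mul0r; lra.
Qed.

Lemma sublinear_geN q x : sublinear q -> - q (- x) <= q x.
Proof.
by move=> hq; have := hq.1 x (- x); rewrite subrr (sublinear0 _ hq); lra.
Qed.

Lemma sublinearZ q a x : sublinear q -> 0 <= a -> q (iota a *: x) = a * q x.
Proof.
move=> hq; have [_ qZ] := hq; rewrite le_eqVlt => /predU1P[<-|a0].
  by rewrite rmorph0 scale0r mul0r sublinear0.
apply/eqP; rewrite eq_le qZ ?(ltW a0)//= -ler_pdivlMl//.
have := qZ a^-1 (iota a *: x); rewrite invr_ge0 => /(_ (ltW a0)).
by rewrite scalerA -rmorphM mulVf ?gt_eqF// rmorph1 scale1r.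
Qed.

(** Common source of sublinearity for three infima: along a ray, over a chain, and over translates
    by a subspace. *)
Lemma inf_sublinear (I : Type) (D : set I) (F : I -> V -> R) :
  D !=set0 ->
  (forall x, has_lbound [set F i x | i in D]) ->
  (forall i j x y, D i -> D j ->
     exists2 k, D k & F k (x + y) <= F i x + F j y) ->
  (forall i a x, D i -> 0 <= a ->
     exists2 k, D k & F k (iota a *: x) <= a * F i x) ->
  sublinear (fun x => inf [set F i x | i in D]).
Proof.
move=> [i0 Di0] Flb FD FZ.
have infE i x : D i -> inf [set F i x | i in D] <= F i x.
  by move=> Di; apply: ge_inf => //; exists i.
have le_infE c x :
    (forall i, D i -> c <= F i x) -> c <= inf [set F i x | i in D].
  move=> h; apply: lb_le_inf; first by exists (F i0 x), i0.
  by move=> _ [i Di <-]; exact: h.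
split=> [x y|a x a0].
  rewrite -lerBlDl; apply: (le_infE) => j Dj; rewrite lerBlDr -lerBlDl.
  apply: (le_infE) => i Di.
  have [k Dk le_k] := FD j i y x Dj Di.
  have := infE k (y + x) Dk; rewrite [y + x]addrC => le_k'.
  by rewrite [y + x]addrC in le_k; lra.
move: a0; rewrite le_eqVlt => /predU1P[<-|a0].
  have [k Dk] := FZ i0 0 x Di0 (lexx _).
  by rewrite !mul0r; apply: le_trans; exact: infE.
rewrite -ler_pdivrMl//; apply: (le_infE) => i Di; rewrite ler_pdivrMl//.
have [k Dk] := FZ i a x Di (ltW a0).
by apply: le_trans; exact: infE.
Qed.

(* The witness is x |-> inf_(t >= 0) (q (x + t y) - t q y). *)
Lemma sublinear_sharpen q y : sublinear q ->
  exists q', [/\ sublinear q', forall x, q' x <= q x & q' (- y) <= - q y].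
Proof.
move=> hq; have [qD qZ] := hq.
pose D : set R := [set t | 0 <= t].
pose F t x := q (x + iota t *: y) - t * q y.
have Flb x : has_lbound [set F t x | t in D].
  exists (- q (- x)) => _ [t Dt <-]; rewrite /F.
  have := qD (x + iota t *: y) (- x); rewrite addrAC subrr add0r.
  by rewrite (sublinearZ _ _ _ hq Dt); lra.
have infE t x : D t -> inf [set F t x | t in D] <= F t x.
  by move=> Dt; apply: ge_inf => //; exists t.
exists (fun x => inf [set F t x | t in D]); split.
- apply: inf_sublinear => //; first by exists 0; rewrite /D /=.
  + move=> s t x z Ds Dt; exists (s + t); first exact: addr_ge0.
    rewrite /F rmorphD scalerDl addrACA.
    have := qD (x + iota s *: y) (z + iota t *: y); lra.
  + move=> t a x Dt a0; exists (a * t); first exact: mulr_ge0.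
    rewrite /F rmorphM -scalerA -scalerDr.
    by have := qZ a (x + iota t *: y) a0; lra.
- move=> x; have := infE 0 x (lexx _).
  by rewrite /F rmorph0 scale0r addr0 mul0r subr0.
- have := infE 1 (- y) ler01.
  by rewrite /F rmorph1 scale1r addNr (sublinear0 _ hq) mul1r sub0r.
Qed.

(** Zorn's lemma for the reversed pointwise order, in which a nonempty chain is bounded by its
    pointwise infimum. *)
Lemma sublinear_minimal p : sublinear p ->
  exists q, [/\ sublinear q, forall x, q x <= p x &
    forall q', sublinear q' -> (forall x, q' x <= q x) ->
      forall x, q x <= q' x].
Proof.
move=> hp; pose T := {q : V -> R | sublinear q /\ forall x, q x <= p x}.
pose mk q (hq : sublinear q) (qp : forall x, q x <= p x) : T :=
  exist _ q (conj hq qp).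
pose r (s t : T) : bool := `[< forall x, sval t x <= sval s x >].
have [||A Atot|q qmax] := @ZL_preorder T (mk p hp (fun=> lexx _)) r.
- by move=> t; apply/asboolP.
- move=> s t u /asboolP h1 /asboolP h2; apply/asboolP => x.
  exact: le_trans (h2 x) (h1 x).
- have [[t0 At0]|A0] := pselect (A !=set0); last first.
    exists (mk p hp (fun=> lexx _)) => s As.
    by case: A0; exists s.
  (* Each [t] in the chain satisfies [t x >= - t (- x) >= - p (- x)]. *)
  have Alb x : has_lbound [set sval t x | t in A].
    exists (- p (- x)) => _ [t At <-].
    have [ht tp] := svalP t; have := sublinear_geN _ x ht.
    by apply: le_trans; rewrite lerN2.
  have hinf : sublinear (fun x => inf [set sval t x | t in A]).
    apply: inf_sublinear => //; first by exists t0.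
    + move=> s t x y As At.
      have [/asboolP st|/asboolP ts] := Atot s t As At.
      * exists t => //; apply: le_trans ((svalP t).1.1 x y) _.
        by rewrite lerD2r.
      * exists s => //; apply: le_trans ((svalP s).1.1 x y) _.
        by rewrite lerD2l.
    + by move=> t a x At a0; exists t => //; exact: (svalP t).1.2.
  have infp x : inf [set sval t x | t in A] <= p x.
    apply: le_trans ((svalP t0).2 x); apply: ge_inf => //.
    by exists t0.
  exists (mk _ hinf infp) => s As; apply/asboolP => x /=.
  by apply: ge_inf => //; exists s.
have [hq qp] := svalP q; exists (sval q); split=> // q' hq' q'q.
have q'p x : q' x <= p x by exact: le_trans (q'q x) (qp x).
by have /asboolP := qmax (mk q' hq' q'p) (asboolT q'q).
Qed.

Definition real_linear (f : V -> R) :=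
  forall a x y, f (iota a *: x + y) = a * f x + f y.

(** Sharpening at [x] and minimality give [q (- x) <= - q x], so [q] is odd; oddness turns
    subadditivity into additivity. *)
Lemma minimal_sublinear_linear q : sublinear q ->
  (forall q', sublinear q' -> (forall x, q' x <= q x) ->
     forall x, q x <= q' x) ->
  real_linear q.
Proof.
move=> hq qmin; have [qD qZ] := hq.
have qN x : q (- x) = - q x.
  apply/eqP; rewrite eq_le; apply/andP; split; last first.
    by have := sublinear_geN _ x hq; lra.
  have [q' [hq' q'q q'x]] := sublinear_sharpen _ x hq.
  exact: le_trans (qmin _ hq' q'q _) q'x.
have qDE x y : q (x + y) = q x + q y.
  apply/eqP; rewrite eq_le qD /=.
  by have := qD (x + y) (- y); rewrite addrK qN; lra.
move=> a x y; rewrite qDE; congr (_ + _).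
have [a0|a0] := leP 0 a; first exact: sublinearZ.
have := sublinearZ _ (- a) x hq; rewrite oppr_ge0 => /(_ (ltW a0)).
by rewrite rmorphN scaleNr qN; lra.
Qed.

(* Sharpening the distance p to M at x0 before taking a minimal sublinear
   functional below it forces a positive value at x0. *)
Lemma real_separation (N : V -> R) (M : set V) (x0 : V) (e : R) :
  sublinear N -> (forall x, 0 <= N x) ->
  M 0 -> (forall a x y, M x -> M y -> M (iota a *: x + y)) ->
  0 < e -> (forall m, M m -> e <= N (x0 - m)) ->
  exists f : V -> R, [/\ real_linear f, forall x, f x <= N x,
    forall m, M m -> f m = 0 & 0 < f x0].
Proof.
move=> hN N0 M0 Mlin e0 Me.
pose F m x := N (x - m); pose p x := inf [set F m x | m in M].
have Flb x : has_lbound [set F m x | m in M].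
  by exists 0 => _ [m _ <-]; exact: N0.
have hp : sublinear p.
  apply: inf_sublinear => //; first by exists 0.
    move=> m n x y Mm Mn; exists (m + n).
      by have := Mlin 1 m n Mm Mn; rewrite rmorph1 scale1r.
    by rewrite /F opprD addrACA; exact: hN.1.
  move=> m a x Mm a0; exists (iota a *: m).
    by have := Mlin a m 0 Mm M0; rewrite addr0.
  by rewrite /F -scalerBr; exact: hN.2.
have pN x : p x <= N x.
  by apply: ge_inf => //; exists 0 => //; rewrite /F subr0.
have pM m : M m -> p m <= 0.
  move=> Mm; rewrite -(sublinear0 _ hN); apply: ge_inf => //.
  by exists m => //; rewrite /F subrr.
have px0 : e <= p x0.
  apply: lb_le_inf; first by exists (F 0 x0), 0.
  by move=> _ [m Mm <-]; exact: Me.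
have [p' [hp' p'p p'x0]] := sublinear_sharpen _ x0 hp.
have [f [hf fp' fmin]] := sublinear_minimal _ hp'.
have flin := minimal_sublinear_linear _ hf fmin.
have fN x : f (- x) = - f x.
  have := flin (-1) x 0; rewrite rmorphN1 scaleN1r addr0 (sublinear0 _ hf).
  by rewrite mulN1r addr0.
have fp x : f x <= p x := le_trans (fp' x) (p'p x).
exists f; split=> // [x|m Mm|].
- exact: le_trans (fp x) (pN x).
- apply/eqP; rewrite eq_le (le_trans (fp m) (pM m Mm)) /=.
  have MN : M (- m).
    by have := Mlin (-1) m 0 Mm M0; rewrite rmorphN1 scaleN1r addr0.
  by have := le_trans (fp _) (pM _ MN); rewrite fN; lra.
(* Here [f (- x0) <= p' (- x0) <= - p x0 <= - e]. *)
- by have := fp' (- x0); rewrite fN; lra.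
Qed.

End RealHahnBanach.

(** * Closed subspaces, closed spans, and functionals separating a point from a subspace *)

Section Subspaces.
Context {K : numFieldType} {X : normedModType K}.
Implicit Types (M : set X).

Lemma subspace_zero M : Defs.subspace M -> M 0.
Proof. by move=> [[M0 _] _]; have := M0; rewrite inE. Qed.

Lemma subspace_lin M a x y : Defs.subspace M -> M x -> M y -> M (a *: x + y).
Proof. by move=> [[_ Ml] _] Mx My; have := Ml a x y; rewrite !inE; apply. Qed.

Lemma subspaceD M x y : Defs.subspace M -> M x -> M y -> M (x + y).
Proof.
by move=> sM Mx My; rewrite -[x]scale1r; exact: subspace_lin.
Qed.

Lemma subspaceZ M a x : Defs.subspace M -> M x -> M (a *: x).
Proof.
move=> sM Mx; rewrite -[_ *: _]addr0; apply: subspace_lin => //.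
exact: subspace_zero.
Qed.

Lemma closed_away M x0 : closed M -> ~ M x0 ->
  exists2 e : K, 0 < e & forall m, M m -> ~ `|x0 - m| < e.
Proof.
move=> /closed_openC oM Mx0.
have /nbhs_normP[e /= e0 be] : nbhs x0 (~` M) by exact: open_nbhs_nbhs.
by exists e => // m Mm lt_e; exact: (be m).
Qed.

Lemma join_le (G : set (set X)) M : Defs.subspace M ->
  (forall E, G E -> E `<=` M) -> join G `<=` M.
Proof.
move=> sM GM; have := closure_id M; move: (sM) => [_ cM] [/(_ cM) Mid _].
rewrite Mid; apply: closure_subset => _ [n [a [v [Gv ->]]]].
elim/big_ind: _ => [|x y Mx My|i _]; first exact: subspace_zero.
  exact: subspaceD.
by apply: subspaceZ => //; have [E GE Ev] := Gv i; exact: GM Ev.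
Qed.

Lemma join_ge (G : set (set X)) E : G E -> E `<=` join G.
Proof.
move=> GE x Ex; apply: subset_closure.
exists 1, (fun=> 1), (fun=> x); split; first by move=> _; exists E.
by rewrite big_ord1 scale1r.
Qed.

Definition bounded_scalar (f : X -> K) :=
  scalar f /\ exists C : K, forall x, `|f x| <= C * `|x|.

Definition separates M x0 (f : X -> K) :=
  [/\ bounded_scalar f, forall m, M m -> f m = 0 & f x0 = 1].

End Subspaces.

Lemma real_separating_functional (R : realType) (X : normedModType R)
    (M : set X) (x0 : X) :
  Defs.subspace M -> ~ M x0 -> exists f, separates M x0 f.
Proof.
move=> sM Mx0; have [e e0 Me] := closed_away _ _ sM.2 Mx0.
have hN : sublinear (@idfun R) (fun x : X => `|x|).
  split=> [x y|a x a0]; first exact: ler_normD.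
  by rewrite normrZ ger0_norm.
have [|||m Mm|f [flin fN fM fx0]] :=
  real_separation (@idfun R) (fun x : X => `|x|) M x0 e hN (fun=> normr_ge0 _).
- exact: subspace_zero.
- by move=> a x y Mx My; exact: subspace_lin.
- exact: e0.
- by rewrite leNgt; apply/negP; exact: Me.
have fneg x : f (- x) = - f x.
  have := flin (-1) x 0; rewrite /= scaleN1r addr0 (fM 0 (subspace_zero _ sM)).
  by rewrite mulN1r addr0.
exists (fun x => (f x0)^-1 * f x); split=> [|m /fM ->|].
- split=> [a x y /=|]; first by rewrite flin mulrDr mulrCA.
  exists `|(f x0)^-1| => x; rewrite normrM ler_wpM2l// ler_norml fN andbT.
  by rewrite lerNl -fneg -(normrN x) fN.
- by rewrite mulr0.
- by rewrite mulVf ?gt_eqF.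
Qed.

(* A real-linear f is the real part of the complex-linear
   x |-> f x - i f (i x). *)
Lemma complex_separating_functional (R : realType) (X : normedModType R[i]%C)
    (M : set X) (x0 : X) :
  Defs.subspace M -> ~ M x0 -> exists f, separates M x0 f.
Proof.
move=> sM Mx0; have [e e0 Me] := closed_away _ _ sM.2 Mx0.
(* The norm takes values in [R[i]] but is real, so its real part loses nothing. *)
pose N (x : X) : R := complex.Re `|x|.
have NE x : `|x| = (N x)%:C%C.
  have := normr_ge0 x; rewrite /N; case: (`|x|) => a b; rewrite lecE /=.
  by move=> /andP[/eqP -> _].
have hN : sublinear (real_complex R) N.
  split=> [x y|a x a0].
    by rewrite -lecR rmorphD/= -!NE; exact: ler_normD.
  rewrite -lecR rmorphM /= -!NE normrZ ger0_norm// lecR//.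
have eE : e = (complex.Re e)%:C%C.
  by move: e0; case: (e) => a b; rewrite ltcE /= => /andP[/eqP -> _].
have [| | | |m Mm|f [flin fN fM fx0]] :=
  @real_separation R _ (real_complex R) X _ M x0 (complex.Re e) hN.
- by move=> x; rewrite -lecR -NE normr_ge0.
- exact: subspace_zero.
- by move=> a x y Mx My; exact: subspace_lin.
- by rewrite -ltcR -eE.
- rewrite leNgt; apply/negP => lt_e; apply: (Me m Mm).
  by rewrite NE eE ltcR.
have fneg x : f (- x) = - f x.
  have := flin (-1) x 0; rewrite rmorphN1 scaleN1r addr0.
  by rewrite (fM 0 (subspace_zero _ sM)) mulN1r addr0.
pose g x : R[i]%C := (f x)%:C%C - 'i%C * (f ('i%C *: x))%:C%C.
(* The real part of [g x0] is [f x0], which is positive. *)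
have gx0 : g x0 != 0.
  apply/eqP => /(congr1 (@complex.Re R)) /=.
  by lra.
have glin : scalar g.
  have fD x y : f (x + y) = f x + f y.
    by have := flin 1 x y; rewrite rmorph1 scale1r mul1r.
  have fZ a x : f (a%:C%C *: x) = a * f x.
    by have := flin a x 0; rewrite (fM 0 (subspace_zero _ sM)) !addr0.
  have fE a x : f (a *: x) = complex.Re a * f x + complex.Im a * f ('i%C *: x).
    by rewrite {1}[a]complexE scalerDl fD fZ [X in f (X *: x)]mulrC -scalerA fZ.
  move=> a x y; rewrite /g scalerDr !fD scalerA (fE a) (fE ('i%C * a)).
  case: a => u v; apply/eqP; rewrite eq_complex /=.
  by apply/andP; split; apply/eqP; ring.
have fb y : `|(f y)%:C%C| <= `|y|.
  rewrite NE normc_def /= lecR expr0n addr0 sqrtr_sqr ler_norml fN andbT.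
  by rewrite lerNl -fneg; have := fN (- y); rewrite /N normrN.
exists (fun x => (g x0)^-1 * g x); split=> [|m Mm|].
- split=> [a x y /=|]; first by rewrite glin mulrDr mulrCA.
  exists (`|(g x0)^-1| * (1 + `|'i%C| * `|'i%C|)) => x.
  rewrite normrM -mulrA ler_wpM2l// mulrDl mul1r.
  apply: le_trans (ler_normB _ _) _; apply: lerD; first exact: fb.
  by rewrite normrM -mulrA ler_wpM2l// -normrZ fb.
- have Mim : M ('i%C *: m) by exact: subspaceZ.
  rewrite /g (fM _ Mm) (fM _ Mim) (_ : 0%:C%C = 0 :> R[i]%C)//.
  by rewrite mulr0 subr0 mulr0.
- by rewrite mulVf.
Qed.

Lemma separating_functional (R : realType) (k : scalar_kind)
    (X : normedModType (scalars R k)) (M : set X) (x0 : X) :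
  Defs.subspace M -> ~ M x0 -> exists f, separates M x0 f.
Proof.
case: k X M x0 => X M x0.
  exact: real_separating_functional.
exact: complex_separating_functional.
Qed.

(** * Rank-one operators *)

Section Operators.
Context {K : numFieldType} {X : normedModType K}.
Implicit Types (A B D : bounded_op X) (L : subspace_lattice X).

Lemma bop_addr A x y : A (x + y) = A x + A y.
Proof. by have := (bopP A).1 1 x y; rewrite !scale1r. Qed.

Lemma bop_0r A : A 0 = 0.
Proof. by apply: (addIr (A 0)); rewrite -bop_addr !add0r. Qed.

Lemma bop_scaler A a x : A (a *: x) = a *: A x.
Proof. by have := (bopP A).1 a x 0; rewrite bop_0r !addr0. Qed.

Lemma bop_scaleAl a A B : a *: A * B = a *: (A * B).
Proof. exact: bop_ext. Qed.

Lemma bop_scaleAr a A B : A * (a *: B) = a *: (A * B).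
Proof. by apply: bop_ext => x; exact: bop_scaler. Qed.

Lemma kernel_subspace D : Defs.subspace [set x | D x = 0].
Proof.
split.
  split; first by rewrite inE; exact: bop_0r.
  move=> a x y; rewrite !inE /= => Dx Dy.
  by rewrite bop_addr bop_scaler Dx Dy scaler0 addr0.
move=> x clx; apply/eqP; apply: contrapT => /negP Dx0.
have [_ [C DC]] := bopP D.
have Dx : 0 < `|D x| by rewrite normr_gt0.
have C1 : 0 < `|C| + 1 by rewrite ltr_wpDl.
(* The radius makes [|D x| = |D (x - y)| <= |C| |x - y|] strictly smaller than [|D x|]; the added 1
   keeps the denominator positive. *)
have [y [/= Dy xy]] : [set x | D x = 0] `&` ball x (`|D x| / (`|C| + 1)) !=set0.
  by apply: clx; apply: nbhsx_ballx; rewrite divr_gt0.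
move: xy; rewrite -ball_normE /= ltr_pdivlMr// => lt_xy.
suff : `|D x| < `|D x| by rewrite ltxx.
apply: le_lt_trans lt_xy.
have -> : D x = D (x - y) by rewrite bop_addr -scaleN1r bop_scaler Dy scaler0 addr0.
have h := DC (x - y).
have -> : `|D (x - y)| = `| `|D (x - y)| | by rewrite normr_id.
apply: le_trans (_ : `|C * `|x - y| | <= _).
  by rewrite !ger0_norm// (le_trans _ h).
by rewrite normrM normr_id mulrC ler_wpM2l// lerDl.
Qed.

Lemma lower_subspace L E : Defs.subspace (lower L E).
Proof.
by apply: (@members_subspace _ _ L); apply: members_join => F [].
Qed.

Lemma bounded_scalarD (f : X -> K) x y :
  bounded_scalar f -> f (x + y) = f x + f y.
Proof. by move=> [fl _]; have := fl 1 x y; rewrite scale1r mul1r. Qed.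

Lemma bounded_scalarZ (f : X -> K) a x :
  bounded_scalar f -> f (a *: x) = a * f x.
Proof.
move=> fb; have f0 : f 0 = 0.
  by apply: (addIr (f 0)); rewrite -bounded_scalarD// !add0r.
by have := fb.1 a x 0; rewrite f0 !addr0.
Qed.

(** A member of [L] either contains [E], hence the range of the operator, or is one of the subspaces
    joined in E_-, where [f] vanishes. *)
Lemma rank_one_alg L E x f : members L E -> E x ->
  bounded_scalar f -> (forall y, lower L E y -> f y = 0) ->
  exists T : alg L, forall z, T z = f z *: x.
Proof.
move=> LE Ex [flin [C fC]] f0.
have Tb : bounded_linear (fun z => f z *: x).
  split=> [a y z|]; first by rewrite flin scalerDl scalerA.
  exists (`|x| * C) => z; rewrite normrZ mulrC -mulrA.
  exact: ler_wpM2l.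
pose T := BoundedOp (introT (bounded_linearP _) Tb).
have TL : alg_set L T.
  move=> F LF z Fz; rewrite /T /=.
  have [EF|EF] := pselect (E `<=` F).
    by apply: subspaceZ; [exact: (members_subspace LF)|exact: EF].
  rewrite f0 ?scale0r; first exact: subspace_zero (members_subspace LF).
  exact: (@join_ge _ _ [set F | members L F /\ ~ (E `<=` F)] F).
by exists (AlgOp (introT (alg_setP _ _) TL)).
Qed.

(** Zero vectors and zero functionals are allowed, which makes the class stable under multiplication
    by [alg L] on either side. *)
Definition elementary L (T : alg L) := exists E x f,
  [/\ PL L E, E x, bounded_scalar f, forall y, lower L E y -> f y = 0 &
      forall z, T z = f z *: x].

Lemma elementary_mull L (A T : alg L) : elementary L T -> elementary L (A * T).
Proof.
move=> [E [x [f [PE Ex fb f0 Tf]]]]; exists E, (A x), f; split=> //.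
  by have /alg_setP := alg_subproof A; apply => //; exact: PE.1.
by move=> z; rewrite alg_opM bopM Tf bop_scaler.
Qed.

Lemma lower_alg L (A : alg L) E y : lower L E y -> lower L E (A y).
Proof.
have /alg_setP := alg_subproof A; apply.
by apply: members_join => F [].
Qed.

(** The product of x (x) f with [A] is x (x) (f o A), and f o A still vanishes on E_- because [A]
    leaves E_- invariant. *)
Lemma elementary_mulr L (T A : alg L) : elementary L T -> elementary L (T * A).
Proof.
move=> [E [x [f [PE Ex [flin [C fC]] f0 Tf]]]].
exists E, x, (f \o A); split=> //.
- split=> [a y z|]; first by rewrite /= bop_addr bop_scaler flin.
  have [_ [C' AC]] := bopP A.
  exists (`|C| * C') => y; rewrite /= -mulrA.
  apply: le_trans (_ : `|C| * `|A y| <= _); last exact: ler_wpM2l.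
  have -> : `|f (A y)| = `| `|f (A y)| | by rewrite normr_id.
  have h := fC (A y); rewrite -[`|A y|]normr_id -normrM.
  by rewrite normr_id [leRHS]ger0_norm // (le_trans _ h).
- by move=> y /(lower_alg _ A); exact: f0.
- by move=> z; rewrite alg_opM bopM Tf.
Qed.

Lemma alg_ext L (A B : alg L) : (forall z, A z = B z) -> A = B.
Proof. by move=> AB; apply/val_inj/bop_ext. Qed.

(** Here [W] is v (x) f with [v = (1 - f x) *: y + x]; the coefficient is chosen to make
    [f v = 1]. *)
Lemma idempotent_same_functional L (P S : alg L) f x y :
  bounded_scalar f -> f y = 1 ->
  (forall z, P z = f z *: y) -> (forall z, S z = f z *: x) ->
  let W := (1 - f x) *: P + S in W * W = W.
Proof.
move=> fb fy Pf Sf W; apply: alg_ext => z; rewrite alg_opM bopM.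
have WE t : W t = (1 - f x) *: (f t *: y) + f t *: x.
  by rewrite /W alg_opD bopD alg_opZ bopZ Pf Sf.
rewrite (WE (W z)); have -> : f (W z) = f z; last by rewrite -WE.
by rewrite WE bounded_scalarD// !bounded_scalarZ// fy; ring.
Qed.

(** Dually, [W] is y (x) h with h = (1 - f y) g + f, so that h(y) = 1. *)
Lemma idempotent_same_range L (P S : alg L) f g y :
  bounded_scalar f -> bounded_scalar g -> g y = 1 ->
  (forall z, P z = g z *: y) -> (forall z, S z = f z *: y) ->
  let W := (1 - f y) *: P + S in W * W = W.
Proof.
move=> fb gb gy Pg Sf W; apply: alg_ext => z; rewrite alg_opM bopM.
have WE t : W t = ((1 - f y) * g t + f t) *: y.
  by rewrite /W alg_opD bopD alg_opZ bopZ Pg Sf scalerA scalerDl.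
rewrite !WE !bounded_scalarZ// gy; congr (_ *: _); ring.
Qed.

End Operators.

(** * Detecting the zero operator by products with rank-one operators *)

Section ElementaryTests.
Context {R : realType} {k : scalar_kind} {X : normedModType (scalars R k)}.
Implicit Types (L : subspace_lattice X) (D : bounded_op X).

Lemma PL_functional L E : PL L E -> exists y f,
  [/\ E y, bounded_scalar f, forall z, lower L E z -> f z = 0 & f y = 1].
Proof.
move=> [LE /existsNP[y /not_implyP[Ey Ey_]]].
have [f [fb f0 fy]] := separating_functional _ _ _ _ _ (lower_subspace L E) Ey_.
by exists y, f.
Qed.

(** For [y] in [E] and [f z = 1], applying [D] after y (x) f to [z] gives [D y = 0]; the closed
    kernel of [D] thus contains every [E]. *)
Lemma eq0_of_join L D : join (PL L) = setT ->
  (forall T : alg L, elementary L T -> D * alg_op T = 0) -> D = 0.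
Proof.
move=> jT DT; apply: bop_ext => x.
suff : setT `<=` [set x | D x = 0] by exact.
rewrite -jT; apply: join_le; first exact: kernel_subspace.
move=> E PE y Ey /=.
have [z [f [Ez fb f0 fz]]] := PL_functional _ _ PE.
have [T Tf] := rank_one_alg _ _ _ _ PE.1 Ey fb f0.
have : D * alg_op T = 0 by apply: DT; exists E, y, f.
by move/(congr1 (fun A : bounded_op X => A z)); rewrite bopM Tf fz scale1r.
Qed.

(** If [D x] were outside E_-, some [f] vanishing on E_- would have [f (D x) = 1]; then y (x) f
    sends [D x] to [y], which is nonzero when chosen in [E] outside E_-. *)
Lemma eq0_of_meet L D : meet [set lower L E | E in PL L] = [set 0] ->
  (forall T : alg L, elementary L T -> alg_op T * D = 0) -> D = 0.
Proof.
move=> m0 TD; apply: bop_ext => x.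
suff : meet [set lower L E | E in PL L] (D x) by rewrite m0.
move=> _ [E PE <-]; apply: contrapT => DxE.
have [f [fb f0 fDx]] := separating_functional _ _ _ _ _ (lower_subspace L E) DxE.
have [LE /existsNP[y /not_implyP[Ey Ey_]]] := PE.
have [T Tf] := rank_one_alg _ _ _ _ LE Ey fb f0.
have : alg_op T * D = 0 by apply: TD; exists E, y, f.
move/(congr1 (fun A : bounded_op X => A x)); rewrite bopM Tf fDx scale1r.
move=> y0; apply: Ey_; rewrite y0; exact: subspace_zero (lower_subspace L E).
Qed.

End ElementaryTests.

(** * Mappings derivable at zero *)

Section DerivableAtZero.
Context {R : realType} {k : scalar_kind} {X : normedModType (scalars R k)}.
Context {L : subspace_lattice X} (delta : {linear alg L -> bounded_op X}).
Implicit Types (A B P S T : alg L).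

(** In terms of phi this reads phi(A T, B) = phi(A, T B). *)
Definition balanced T := forall A B,
  delta (A * T) * alg_op B + alg_op (A * T) * delta B =
  delta A * alg_op (T * B) + alg_op A * delta (T * B).

Lemma balanced_idempotent P : derivable_at_zero delta -> P * P = P -> balanced P.
Proof.
move=> d0 PP A B.
have z1 : (A * P) * (B - P * B) = 0.
  by rewrite mulrBr !mulrA -(mulrA A P P) PP subrr.
have z2 : (A - A * P) * (P * B) = 0.
  by rewrite mulrBl !mulrA -(mulrA A P P) PP subrr.
have := d0 _ _ z1; have := d0 _ _ z2.
rewrite z1 z2 !raddf0 !raddfB !mulrBl !mulrBr /= => e2 e1.
(* [e1] gives phi(A P, B) = phi(A P, P B) and [e2] gives phi(A, P B) = phi(A P, P B). *)
move: e1 e2; rewrite !(addrACA _ (- _)) -!opprD.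
by move=> /esym/subr0_eq -> /esym/subr0_eq ->.
Qed.

Lemma alg_scaleAl a A B : a *: A * B = a *: (A * B).
Proof. by apply: val_inj; exact: bop_scaleAl. Qed.

Lemma alg_scaleAr a A B : A * (a *: B) = a *: (A * B).
Proof. by apply: val_inj; exact: bop_scaleAr. Qed.

Lemma balanced_lin a S T : balanced S -> balanced T -> balanced (a *: S + T).
Proof.
move=> hS hT A B.
have -> : A * (a *: S + T) = a *: (A * S) + A * T by rewrite mulrDr alg_scaleAr.
have -> : (a *: S + T) * B = a *: (S * B) + T * B by rewrite mulrDl alg_scaleAl.
rewrite !linearP !alg_opD !alg_opZ !mulrDl !mulrDr !bop_scaleAl !bop_scaleAr.
by rewrite addrACA -scalerDr hS hT scalerDr addrACA.
Qed.

(** The factors cross over one at a time, [T] first. *)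
Lemma balanced_mul S T : balanced S -> balanced T -> balanced (S * T).
Proof. by move=> hS hT A B; rewrite mulrA hT hS !mulrA. Qed.

(* With y in E and g vanishing on E_- such that g y = 1, x (x) f is the product
   of x (x) g and y (x) f, and both factors become idempotent after adding a
   multiple of y (x) g. *)
Lemma elementary_balanced T :
  derivable_at_zero delta -> elementary L T -> balanced T.
Proof.
move=> d0 [E [x [f [PE Ex fb f0 Tf]]]].
have [y [g [Ey gb g0 gy]]] := PL_functional _ _ PE.
have [S Sg] := rank_one_alg _ _ _ _ PE.1 Ex gb g0.
have [U Uf] := rank_one_alg _ _ _ _ PE.1 Ey fb f0.
have [P Pg] := rank_one_alg _ _ _ _ PE.1 Ey gb g0.
(* [P] is idempotent because [g y = 1], so [W] is a linear combination of two idempotents. *)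
have bal_add c W : (c *: P + W) * (c *: P + W) = c *: P + W -> balanced W.
  move=> WW; have -> : W = (- c) *: P + (c *: P + W).
    by rewrite scaleNr addKr.
  apply: balanced_lin; apply: balanced_idempotent => //.
  apply: alg_ext => z.
  by rewrite alg_opM bopM !Pg bounded_scalarZ// gy mulr1.
have -> : T = S * U.
  apply: alg_ext => z.
  by rewrite alg_opM bopM Uf Sg Tf bounded_scalarZ// gy mulr1.
apply: balanced_mul.
  by apply: (bal_add (1 - g x)); exact: idempotent_same_functional Pg Sg.
by apply: (bal_add (1 - f y)); exact: idempotent_same_range Pg Uf.
Qed.

Context (d0 : derivable_at_zero delta).

Lemma elementary_right A T : elementary L T ->
  delta (A * T) + alg_op A * alg_op T * delta 1 =
  delta A * alg_op T + alg_op A * delta T.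
Proof.
by move=> /(elementary_balanced _ d0)/(_ A 1); rewrite !mulr1.
Qed.

Lemma elementary_left T B : elementary L T ->
  delta (T * B) + delta 1 * alg_op T * alg_op B =
  delta T * alg_op B + alg_op T * delta B.
Proof.
move=> /(elementary_balanced _ d0)/(_ 1 B); rewrite !mul1r => ->.
by rewrite addrC -mulrA.
Qed.

Lemma elementary_delta1 T : elementary L T ->
  delta 1 * alg_op T = alg_op T * delta 1.
Proof.
move=> eT; have := elementary_left _ 1 eT.
by rewrite !mulr1 => /addrI.
Qed.

(** Both [T] and [A * T] commute with [delta 1], so the commutator of [delta 1] and [A] vanishes
    after right multiplication by [T]. *)
Lemma join_commutant : join (PL L) = setT ->
  forall A, delta 1 * alg_op A = alg_op A * delta 1.
Proof.
move=> jT A; apply/eqP; rewrite -subr_eq0; apply/eqP.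
apply: eq0_of_join jT _ => T eT.
rewrite mulrBl -!mulrA elementary_delta1// -alg_opM.
by rewrite elementary_delta1 ?alg_opM ?mulrA ?subrr//; exact: elementary_mull.
Qed.

Lemma meet_commutant : meet [set lower L E | E in PL L] = [set 0] ->
  forall A, delta 1 * alg_op A = alg_op A * delta 1.
Proof.
move=> m0 A; apply/eqP; rewrite -subr_eq0; apply/eqP.
apply: eq0_of_meet m0 _ => T eT.
rewrite mulrBr !mulrA -elementary_delta1// -(alg_opM T A).
rewrite -elementary_delta1 ?alg_opM ?mulrA ?subrr//; exact: elementary_mulr.
Qed.

(** [delta (A * B * T)] is expanded by [elementary_right] for both bracketings; a further expansion
    of [delta (B * T)] leaves the term A B T delta(1), which commutation turns into A delta(1) B
    T. *)
Lemma join_generalized_derivation : join (PL L) = setT ->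
  generalized_derivation delta.
Proof.
move=> jT A B; apply/eqP; rewrite -subr_eq0; apply/eqP.
apply: eq0_of_join jT _ => T eT; apply/eqP; rewrite mulrBl subr_eq0; apply/eqP.
have eBT := elementary_mull _ B T eT.
have e1 := elementary_right (A * B) T eT.
have e2 := elementary_right A (B * T) eBT.
have e3 := congr1 ( *%R (alg_op A)) (elementary_right B T eT).
have e4 := congr1 ( *%R (alg_op A)) (elementary_delta1 (B * T) eBT).
rewrite !alg_opM !mulrDr !mulrA in e1 e2 e3 e4.
rewrite mulrBl mulrDl e4; rewrite e1 in e2.
apply: (addIr (alg_op A * alg_op B * delta T)); rewrite e2 -!addrA.
by congr (_ + _); rewrite [- _ + _]addrC addrA -e3 addrK.
Qed.

(** Mirror image of the previous argument, expanding [delta (T * A * B)] with [elementary_left]. *)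
Lemma meet_generalized_derivation :
  meet [set lower L E | E in PL L] = [set 0] -> generalized_derivation delta.
Proof.
move=> m0 A B; apply/eqP; rewrite -subr_eq0; apply/eqP.
apply: eq0_of_meet m0 _ => T eT; apply/eqP; rewrite mulrBr subr_eq0; apply/eqP.
have eTA := elementary_mulr _ T A eT.
have e1 := elementary_left T (A * B) eT.
have e2 := elementary_left (T * A) B eTA.
have e3 := congr1 ( *%R^~ (alg_op B)) (elementary_left T A eT).
have e4 := congr1 ( *%R^~ (alg_op B)) (elementary_delta1 (T * A) eTA).
rewrite !alg_opM /= !mulrDl !mulrA in e1 e2 e3 e4.
rewrite mulrBr mulrDr !mulrA -e4; rewrite e1 in e2.
apply: (addrI (delta T * alg_op A * alg_op B)); rewrite e2 !addrA.
by rewrite -e3 [RHS]addrAC addrK.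
Qed.

End DerivableAtZero.

Theorem theorem4p2 (R : realType) (k : scalar_kind)
  (X : completeNormedModType (scalars R k)) (L : subspace_lattice X)
  (hL : join (PL L) = setT \/ meet [set lower L E | E in PL L] = [set 0])
  (delta : {linear alg L -> bounded_op X}) :
  (derivable_at_zero delta <->
     generalized_derivation delta /\ commutant (alg_set L) (delta 1)) /\
  (delta 1 = 0 -> (derivable_at_zero delta <-> derivation delta)).
Proof.
have to_generalized : derivable_at_zero delta ->
    generalized_derivation delta /\ commutant (alg_set L) (delta 1).
  move=> d0; split.
    case: hL; first exact: join_generalized_derivation.
    exact: meet_generalized_derivation.
  move=> A /alg_setP AL; rewrite -[A]/(alg_op (AlgOp AL)).
  by case: hL => h; [exact: join_commutant|exact: meet_commutant].
split; first split=> // [[gd cd] A B AB0].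
  (* Commutation turns the correction term into delta(1) A B, which is zero. *)
  rewrite gd -[X in _ - X * _]cd; last exact/alg_setP/alg_subproof.
  by rewrite -mulrA -alg_opM AB0 alg_op0 mulr0 subr0.
move=> d1; split=> [/to_generalized[gd _] A B|hd A B _]; last exact: hd.
by rewrite gd d1 mulr0 mul0r subr0.
Qed.
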